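(* For each $\theta_0\in(0,\pi/2)$, the operating signal-to-noise ratio $\mathsf{SNR}>0$ that produces cutoff angle $\theta_0$ (that is, the unique $\mathsf{SNR}>0$ for which the water level $\nu=\frac{1}{4\,\mathsf{SNR}\,\sin^2\theta_0}$, equivalently the cutoff $\lambda_{\mathrm{cut}}=\frac{1}{\mathsf{SNR}\,\nu}=4\sin^2\theta_0$, satisfies the power constraint $\int_{\lambda_{\mathrm{cut}}}^{4}\big(\nu-\frac{1}{\mathsf{SNR}\,\lambda}\big)f_1(\lambda)\,d\lambda=1$) is $$\mathsf{SNR}(\theta_0)=\frac{1}{\pi}\left[\Big(\frac{\pi}{2}-\theta_0\Big)\Big(1+\frac{1}{2\sin^2\theta_0}\Big)-\frac{3}{2}\cot\theta_0\right].$$ Moreover, the map $\theta_0\mapsto\mathsf{SNR}(\theta_0)$ is a (strictly) decreasing bijection from $(0,\pi/2)$ onto $(0,\infty)$, with $\mathsf{SNR}(\theta_0)\to 0$ as $\theta_0\to\pi/2$ and $\mathsf{SNR}(\theta_0)\sim\frac{1}{4\theta_0^2}\to\infty$ as $\theta_0\to 0$ (i.e. $4\theta_0^2\,\mathsf{SNR}(\theta_0)\to1$ as $\theta_0\to0^+$).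
   Context: The square ($\beta=1$) Marčenko–Pastur density is $f_1(\lambda)=\frac{1}{2\pi}\sqrt{\frac{4-\lambda}{\lambda}}$ for $\lambda\in(0,4]$. In the square canonical MIMO channel with full channel state information at the transmitter (large-antenna limit), for a given $\mathsf{SNR}>0$ the water level $\nu>0$ and the waterfilling cutoff $\lambda_{\mathrm{cut}}\in(0,4)$ are determined by $\lambda_{\mathrm{cut}}=\frac{1}{\mathsf{SNR}\,\nu}$ together with the power constraint $$\int_{\lambda_{\mathrm{cut}}}^{4}\Big(\nu-\frac{1}{\mathsf{SNR}\,\lambda}\Big)f_1(\lambda)\,d\lambda=1.$$ The cutoff (reference) angle $\theta_0\in(0,\pi/2)$ is defined by $\sin^2\theta_0=\lambda_{\mathrm{cut}}/4=\frac{1}{4\nu\,\mathsf{SNR}}$. *)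

(* Defs.v *)
(* Standard library real numbers, with Coquelicot for integrals and limits. *)
From Stdlib Require Import Reals.
From Coquelicot Require Import Coquelicot.
Open Scope R_scope.

(* Square (beta = 1) Marcenko-Pastur density; meaningful for lambda in (0, 4]. *)
Definition mp_density (lambda : R) : R :=
  1 / (2 * PI) * sqrt ((4 - lambda) / lambda).

(* [is_RInt f a b v] asserts both that [f] is integrable on [a, b] and that its
   integral is [v]. *)
Definition power_constraint (snr nu lcut : R) : Prop :=
  is_RInt (fun lambda => (nu - 1 / (snr * lambda)) * mp_density lambda)
    lcut 4 1.

Definition waterfilling (snr nu lcut : R) : Prop :=
  0 < nu /\ 0 < lcut < 4 /\
  lcut = 1 / (snr * nu) /\
  power_constraint snr nu lcut.

Definition has_cutoff_angle (snr theta : R) : Prop :=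
  0 < theta < PI / 2 /\
  exists nu lcut : R,
    waterfilling snr nu lcut /\ (sin theta) ^ 2 = lcut / 4.

Definition SNR_of_angle (theta : R) : R :=
  1 / PI *
  ((PI / 2 - theta) * (1 + 1 / (2 * (sin theta) ^ 2))
   - 3 / 2 * (cos theta / sin theta)).

(* Main.v *)
(** Substituting [lambda = 4 sin^2 phi] turns [f_1(lambda) d lambda] into
    [(4 / PI) cos^2 phi d phi], so the power constraint at cutoff angle [theta]
    reads [S(theta) / SNR = 1] with
    [S(theta) = (1 / PI) * int_theta^(PI/2) (cos^2 phi / sin^2 theta - cot^2 phi) d phi],
    which is elementary. Its derivative is
    [- cos theta / (PI sin^3 theta) * (PI / 2 - theta - sin theta cos theta)],
    negative because [sin x cos x < x] at [x = PI / 2 - theta]; the bijection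
    then follows from [S(PI / 2) = 0], the blow-up at [0] and the intermediate
    value theorem. *)
Require Import Defs.
From Stdlib Require Import Reals Lra Ranalysis5.
From Coquelicot Require Import Coquelicot.
Open Scope R_scope.

(** * Sine on the first quadrant *)

Lemma sin_pos_first_quadrant (t : R) : 0 < t <= PI / 2 -> 0 < sin t.
Proof.
  intros Ht. assert (HPI := PI_RGT_0). apply sin_gt_0; lra.
Qed.

Lemma sin_sqr_lt_1 (t : R) : 0 < t < PI / 2 -> 0 < sin t ^ 2 < 1.
Proof.
  intros Ht.
  assert (Hs : 0 < sin t) by (apply sin_pos_first_quadrant; lra).
  assert (Hc : 0 < cos t) by (apply cos_gt_0; lra).
  assert (H1 := sin2_cos2 t). unfold Rsqr in H1. nra.
Qed.

(** * The power integral in closed form *)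

(** This is [snr] times the integrand of the power constraint when [nu = 1 / (snr * l0)]: the
    signal-to-noise ratio factors out and only the cutoff remains. *)
Definition waterfill_integrand (l0 lambda : R) : R :=
  (1 / l0 - 1 / lambda) * mp_density lambda.

Lemma continuous_waterfill_integrand (l0 l : R) :
  0 < l -> continuous (waterfill_integrand l0) l.
Proof.
  intros Hl. unfold waterfill_integrand, mp_density.
  assert (Hinv : continuous (fun x : R => / x) l)
    by (apply continuous_Rinv; lra).
  apply (continuous_mult (fun x => 1 / l0 - 1 / x)
           (fun x => 1 / (2 * PI) * sqrt ((4 - x) / x))).
  - apply (continuous_minus (fun _ => 1 / l0) (fun x => 1 / x)).
    + apply continuous_const.
    + apply (continuous_mult (fun _ => 1) (fun x => / x));
        [apply continuous_const | exact Hinv].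
  - apply (continuous_mult (fun _ => 1 / (2 * PI))
             (fun x => sqrt ((4 - x) / x))); [apply continuous_const |].
    (* [sqrt] is total and continuous everywhere, so the zero of the radicand at 4 is harmless. *)
    apply (continuous_comp (fun x => (4 - x) / x) sqrt);
      [| apply continuous_sqrt].
    apply (continuous_mult (fun x => 4 - x) (fun x => / x)); [| exact Hinv].
    apply (continuous_minus (fun _ => 4) (fun x => x));
      [apply continuous_const | apply continuous_id].
Qed.

(** At [4 * sin p ^ 2] the radicand is the square of the cotangent, which is nonnegative here;
    [8 * sin p * cos p] is the Jacobian. *)
Lemma waterfill_integrand_subst (l0 p : R) :
  0 < p <= PI / 2 ->
  8 * sin p * cos p * waterfill_integrand l0 (4 * sin p ^ 2)
  = 1 / PI * (4 / l0 * cos p ^ 2 - (cos p / sin p) ^ 2).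
Proof.
  intros Hp. assert (HPI := PI_RGT_0).
  assert (Hs := sin_pos_first_quadrant p Hp).
  assert (Hc : 0 <= cos p) by (apply cos_ge_0; lra).
  unfold waterfill_integrand, mp_density.
  replace ((4 - 4 * sin p ^ 2) / (4 * sin p ^ 2)) with (Rsqr (cos p / sin p)).
  - rewrite sqrt_Rsqr by (apply Rdiv_le_0_compat; lra).
    (* Treating [/ l0] as an atom spares [field] the condition [l0 <> 0], which is not assumed. *)
    unfold Rdiv. set (k := / l0). field. split; lra.
  - assert (H1 := sin2_cos2 p). unfold Rsqr in *.
    replace (4 - 4 * sin p ^ 2) with (4 * (cos p * cos p)) by nra.
    field. lra.
Qed.

(** One integral over the angle is evaluated twice, by change of variables and by the antiderivative
    [F]; uniqueness of the integral equates the results. *)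
Lemma is_RInt_waterfill_integrand (t : R) :
  0 < t < PI / 2 ->
  is_RInt (waterfill_integrand (4 * sin t ^ 2)) (4 * sin t ^ 2) 4
    (SNR_of_angle t).
Proof.
  intros Ht. assert (HPI := PI_RGT_0).
  set (l0 := 4 * sin t ^ 2).
  assert (Hl0 : 0 < l0 < 4)
    by (unfold l0; generalize (sin_sqr_lt_1 t Ht); lra).
  assert (Hst : 0 < sin t) by (apply sin_pos_first_quadrant; lra).
  assert (Hex : ex_RInt (waterfill_integrand l0) l0 4).
  { apply (ex_RInt_continuous (waterfill_integrand l0)). intros z Hz.
    rewrite Rmin_left in Hz by lra. apply continuous_waterfill_integrand. lra. }
  assert (Hcomp := is_RInt_comp (waterfill_integrand l0)
    (fun p => 4 * sin p ^ 2) (fun p => 8 * sin p * cos p) t (PI / 2)).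
  cbv beta in Hcomp.
  rewrite sin_PI2 in Hcomp. replace (4 * 1 ^ 2) with 4 in Hcomp by ring.
  fold l0 in Hcomp.
  (* [(p + sin p * cos p) / 2] is a primitive of cos^2, and [p + cos p / sin p] one of -cot^2. *)
  set (F := fun p : R =>
    1 / PI * (4 / l0 * ((p + sin p * cos p) / 2) + p + cos p / sin p)).
  assert (HF : is_RInt
    (fun p => scal (8 * sin p * cos p) (waterfill_integrand l0 (4 * sin p ^ 2)))
    t (PI / 2) (minus (F (PI / 2)) (F t))).
  { apply (is_RInt_ext
      (fun p => 1 / PI * (4 / l0 * cos p ^ 2 - (cos p / sin p) ^ 2))).
    - intros p Hp. rewrite Rmin_left, Rmax_right in Hp by lra.
      symmetry. apply waterfill_integrand_subst. lra.
    - apply (is_RInt_derive F); intros p Hp;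
        rewrite Rmin_left, Rmax_right in Hp by lra;
        assert (Hs : 0 < sin p) by (apply sin_pos_first_quadrant; lra).
      + unfold F. auto_derive; [lra |].
        assert (H1 := sin2_cos2 p). unfold Rsqr in H1.
        assert (Hs2 : sin p * sin p = 1 - cos p * cos p) by lra.
        apply (Rmult_eq_reg_r (PI * l0 * (sin p) ^ 2));
          [| assert (0 < PI * l0) by nra; assert (0 < sin p ^ 2) by nra; nra].
        field_simplify; try (repeat split; lra).
        replace (sin p ^ 4) with ((sin p * sin p) * (sin p * sin p)) by ring.
        replace (sin p ^ 2) with (sin p * sin p) by ring.
        rewrite Hs2. field.
      + apply (ex_derive_continuous
          (fun p => 1 / PI * (4 / l0 * cos p ^ 2 - (cos p / sin p) ^ 2))).
        auto_derive. lra. }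
  replace (SNR_of_angle t) with (RInt (waterfill_integrand l0) l0 4).
  - apply (RInt_correct (waterfill_integrand l0)). exact Hex.
  - transitivity (minus (F (PI / 2)) (F t)).
    + rewrite <- (is_RInt_unique _ _ _ _ HF). symmetry.
      apply is_RInt_unique. apply Hcomp.
      * intros p Hp. rewrite Rmin_left, Rmax_right in Hp by lra.
        apply continuous_waterfill_integrand.
        assert (Hs : 0 < sin p) by (apply sin_pos_first_quadrant; lra). nra.
      * intros p _. split; [auto_derive; [exact I | ring] |].
        apply (ex_derive_continuous (fun p => 8 * sin p * cos p)).
        auto_derive. exact I.
    (* As [4 / l0 = 1 / sin t ^ 2], the product [sin t * cos t] yields half a cotangent; with the
       one already in [F] this makes the factor 3/2. *)
    + unfold minus, plus, opp, F, SNR_of_angle, l0; simpl.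
      rewrite sin_PI2, cos_PI2. field. lra.
Qed.

(** * From the power constraint to the operating SNR *)

(** By linearity the power integral is [SNR_of_angle t / snr], which is 1 for exactly one [snr]. *)
Lemma power_constraint_iff (snr t : R) :
  0 < snr -> 0 < t < PI / 2 ->
  power_constraint snr (1 / (4 * snr * sin t ^ 2)) (4 * sin t ^ 2)
  <-> snr = SNR_of_angle t.
Proof.
  intros Hsnr Ht.
  assert (Hs := sin_sqr_lt_1 t Ht).
  assert (Hint : is_RInt
    (fun l => (1 / (4 * snr * sin t ^ 2) - 1 / (snr * l)) * mp_density l)
    (4 * sin t ^ 2) 4 (/ snr * SNR_of_angle t)).
  { eapply is_RInt_ext;
      [| apply (is_RInt_scal _ _ _ (/ snr) _ (is_RInt_waterfill_integrand t Ht))].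
    intros l Hl. rewrite Rmin_left in Hl by lra.
    unfold scal; simpl; unfold mult; simpl. unfold waterfill_integrand.
    field. repeat split; try lra.
    intros H0. rewrite H0 in Hs. lra. }
  unfold power_constraint. split.
  - intros H.
    assert (E := is_RInt_unique _ _ _ _ H).
    rewrite (is_RInt_unique _ _ _ _ Hint) in E.
    apply (Rmult_eq_reg_l (/ snr)); [| apply Rinv_neq_0_compat; lra].
    rewrite E. field. lra.
  - intros H. rewrite <- H, Rinv_l in Hint by lra. exact Hint.
Qed.

(** The angle fixes [lcut], and then [lcut = 1 / (snr * nu)] fixes [nu], so the existential has a
    single candidate. *)
Lemma has_cutoff_angle_iff (snr t : R) :
  0 < snr -> 0 < t < PI / 2 ->
  has_cutoff_angle snr t <->
  power_constraint snr (1 / (4 * snr * sin t ^ 2)) (4 * sin t ^ 2).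
Proof.
  intros Hsnr Ht. assert (Hs := sin_sqr_lt_1 t Ht). split.
  - intros [_ [nu [lcut [[Hnu [Hl [Hlcut Hpow]]] Hsin]]]].
    assert (El : lcut = 4 * sin t ^ 2) by lra.
    assert (En : nu = 1 / (4 * snr * sin t ^ 2)).
    { replace (4 * snr * sin t ^ 2) with (snr * lcut) by (rewrite El; ring).
      rewrite Hlcut. field. split; lra. }
    rewrite <- El, <- En. exact Hpow.
  - intros Hpow. split; [exact Ht |].
    exists (1 / (4 * snr * sin t ^ 2)), (4 * sin t ^ 2).
    assert (Hp : 0 < 4 * snr * sin t ^ 2) by (apply Rmult_lt_0_compat; lra).
    repeat split; try lra.
    + apply Rdiv_lt_0_compat; lra.
    + field. split; [| lra]. intros H0. rewrite H0 in Hs. lra.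
    + exact Hpow.
Qed.

(** * Derivative, monotonicity and positivity *)

(** Including [PI / 2], where the formula is still smooth, lets later arguments use the value 0
    taken there. *)
Lemma is_derive_SNR_of_angle (t : R) :
  0 < t <= PI / 2 ->
  is_derive SNR_of_angle t
    (- (cos t / (PI * sin t ^ 3) * (PI / 2 - t - sin t * cos t))).
Proof.
  intros Ht. assert (HPI := PI_RGT_0).
  assert (Hs := sin_pos_first_quadrant t Ht).
  unfold SNR_of_angle. auto_derive; [repeat split; nra |].
  assert (H1 := sin2_cos2 t). unfold Rsqr in H1.
  apply (Rmult_eq_reg_r (2 * PI * sin t ^ 3));
    [| assert (0 < sin t ^ 3) by (apply pow_lt; lra); nra].
  field_simplify; try (repeat split; lra).
  replace (sin t ^ 4) with (sin t ^ 2 * (sin t * sin t)) by ring.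
  replace (sin t * sin t) with (1 - cos t * cos t) by lra. field. lra.
Qed.

Lemma SNR_of_angle_PI2 : SNR_of_angle (PI / 2) = 0.
Proof.
  assert (HPI := PI_RGT_0).
  unfold SNR_of_angle. rewrite sin_PI2, cos_PI2. field. lra.
Qed.

Lemma SNR_of_angle_decreasing (t1 t2 : R) :
  0 < t1 -> t1 < t2 -> t2 <= PI / 2 -> SNR_of_angle t2 < SNR_of_angle t1.
Proof.
  intros H1 H12 H2. assert (HPI := PI_RGT_0).
  destruct (MVT_cor2 SNR_of_angle
    (fun t => - (cos t / (PI * sin t ^ 3) * (PI / 2 - t - sin t * cos t)))
    t1 t2 H12) as [c [Hc Hct]].
  { intros c Hc. apply is_derive_Reals, is_derive_SNR_of_angle. lra. }
  assert (Hs : 0 < sin c) by (apply sin_pos_first_quadrant; lra).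
  assert (Hcos : 0 < cos c) by (apply cos_gt_0; lra).
  (* As [sin c <= 1], this bound suffices for [sin c * cos c < PI / 2 - c]; it is sin x < x at the
     complementary angle. *)
  assert (Hlt : cos c < PI / 2 - c).
  { rewrite cos_sin. rewrite <- sin_PI_x.
    replace (PI - (PI / 2 + c)) with (PI / 2 - c) by lra.
    apply sin_lt_x. lra. }
  assert (Hs1 := SIN_bound c).
  assert (0 < cos c / (PI * sin c ^ 3)).
  { apply Rdiv_lt_0_compat; [lra |].
    apply Rmult_lt_0_compat; [lra | apply pow_lt; lra]. }
  assert (0 < PI / 2 - c - sin c * cos c) by nra.
  assert (0 < cos c / (PI * sin c ^ 3) * (PI / 2 - c - sin c * cos c))
    by (apply Rmult_lt_0_compat; lra).
  nra.
Qed.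

Lemma SNR_of_angle_pos (t : R) : 0 < t < PI / 2 -> 0 < SNR_of_angle t.
Proof.
  intros Ht. rewrite <- SNR_of_angle_PI2.
  apply SNR_of_angle_decreasing; lra.
Qed.

Lemma continuous_SNR_of_angle (t : R) :
  0 < t <= PI / 2 -> continuous SNR_of_angle t.
Proof.
  intros Ht. apply (ex_derive_continuous SNR_of_angle). eexists.
  apply is_derive_SNR_of_angle, Ht.
Qed.

(** * Limits at both ends of the quadrant *)

Lemma SNR_of_angle_lim_PI2 :
  filterlim SNR_of_angle (at_left (PI / 2)) (locally 0).
Proof.
  assert (HPI := PI_RGT_0). rewrite <- SNR_of_angle_PI2.
  apply (filterlim_filter_le_1 (F := locally (PI / 2)) SNR_of_angle).
  - apply filter_le_within.
  - apply continuous_SNR_of_angle. lra.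
Qed.

Lemma lim_at_right_0 (f : R -> R) :
  continuous f 0 -> filterlim f (at_right 0) (locally (f 0)).
Proof.
  intros Hf. apply (filterlim_filter_le_1 (F := locally 0) f).
  - apply filter_le_within.
  - exact Hf.
Qed.

Lemma filterlim_mult_R (F : (R -> Prop) -> Prop) (FF : Filter F)
  (f g : R -> R) (a b : R) :
  filterlim f F (locally a) -> filterlim g F (locally b) ->
  filterlim (fun x => f x * g x) F (locally (a * b)).
Proof.
  intros Hf Hg.
  exact (filterlim_comp_2 f g Rmult Hf Hg (filterlim_mult a b)).
Qed.

Lemma lim_id_div_sin :
  filterlim (fun t => t / sin t) (at_right 0) (locally 1).
Proof.
  assert (Hsinc : filterlim (fun t => sin t / t) (at_right 0) (locally 1)).
  { apply (filterlim_filter_le_1 (F := locally' 0) (fun t => sin t / t));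
      [| exact is_lim_sinc_0].
    intros P [d Hd]. exists d. intros y Hy Hy0. apply Hd; [exact Hy | lra]. }
  assert (Hinv : filterlim (fun t => / (sin t / t)) (at_right 0) (locally 1)).
  { apply (filterlim_comp _ _ _ (fun t => sin t / t) Rinv _ _ _ Hsinc).
    rewrite <- Rinv_1 at 2. apply (continuous_Rinv 1). lra. }
  apply (filterlim_ext (fun t => / (sin t / t))); [| exact Hinv].
  (* Inversion is total, with [/ 0 = 0], so the identity holds for every [t]. *)
  intros t. unfold Rdiv. rewrite Rinv_mult, Rinv_inv. ring.
Qed.

(** With q = [t / sin t], which tends to 1, the function equals A + B q^2 + C q, where [A], [B], [C]
    are continuous at 0 with values 0, 1, 0. *)
Lemma SNR_of_angle_equiv_0 :
  filterlim (fun t => 4 * t ^ 2 * SNR_of_angle t) (at_right 0) (locally 1).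
Proof.
  assert (HPI := PI_RGT_0).
  set (A := fun t : R => 4 / PI * (PI / 2 - t) * t ^ 2).
  set (B := fun t : R => 2 / PI * (PI / 2 - t)).
  set (C := fun t : R => - (6 / PI) * (t * cos t)).
  assert (HA : filterlim A (at_right 0) (locally (A 0))).
  { apply lim_at_right_0, (ex_derive_continuous A). unfold A.
    auto_derive. exact I. }
  assert (HB : filterlim B (at_right 0) (locally (B 0))).
  { apply lim_at_right_0, (ex_derive_continuous B). unfold B.
    auto_derive. exact I. }
  assert (HC : filterlim C (at_right 0) (locally (C 0))).
  { apply lim_at_right_0, (ex_derive_continuous C). unfold C.
    auto_derive. exact I. }
  assert (Hq := lim_id_div_sin).
  assert (Hq2 := filterlim_mult_R _ _ _ _ _ _ Hq Hq).
  assert (HBq := filterlim_mult_R _ _ _ _ _ _ HB Hq2).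
  assert (HCq := filterlim_mult_R _ _ _ _ _ _ HC Hq).
  assert (H1 := filterlim_comp_2 _ _ Rplus HBq HCq (filterlim_plus _ _)).
  assert (H2 := filterlim_comp_2 _ _ Rplus HA H1 (filterlim_plus _ _)).
  replace (locally 1) with
    (locally (plus (A 0) (plus (B 0 * (1 * 1)) (C 0 * 1)))).
  - eapply filterlim_ext; [| exact H2].
    intros t. unfold A, B, C, SNR_of_angle.
    unfold Rdiv. rewrite !Rinv_mult, <- pow_inv. set (s := / sin t). field. lra.
  - f_equal. unfold plus, A, B, C; simpl. field. lra.
Qed.

(** Near 0 the product [4 * t ^ 2 * SNR_of_angle t] exceeds 1/2, so the SNR exceeds 1/(8 t^2). *)
Lemma SNR_of_angle_lim_0 :
  filterlim SNR_of_angle (at_right 0) (Rbar_locally p_infty).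
Proof.
  assert (Hgt : at_right 0 (fun t => 1 / 2 < 4 * t ^ 2 * SNR_of_angle t)).
  { apply SNR_of_angle_equiv_0, (open_gt (1 / 2)). lra. }
  destruct Hgt as [d Hd].
  intros P [M HM].
  (* [K >= 1] makes [t < / (8 * K)] imply both [t < 1] and [t * K < 1 / 8], hence
     [4 * t ^ 2 * K < 1 / 2]. *)
  set (K := Rmax M 1).
  assert (HK : 1 <= K) by apply Rmax_r.
  assert (HMK : M <= K) by apply Rmax_l.
  assert (He : 0 < Rmin d (/ (8 * K))).
  { apply Rmin_pos; [apply cond_pos | apply Rinv_0_lt_compat; lra]. }
  exists (mkposreal _ He). intros t Hball Ht. apply HM.
  assert (Hlt : t < Rmin d (/ (8 * K))).
  { change (Rabs (t - 0) < Rmin d (/ (8 * K))) in Hball.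
    rewrite Rminus_0_r, Rabs_right in Hball; lra. }
  assert (Htd : t < d) by (eapply Rlt_le_trans; [exact Hlt | apply Rmin_l]).
  assert (HtK : t < / (8 * K))
    by (eapply Rlt_le_trans; [exact Hlt | apply Rmin_r]).
  assert (Hb : 1 / 2 < 4 * t ^ 2 * SNR_of_angle t).
  { apply Hd; [| exact Ht]. change (Rabs (t - 0) < d).
    rewrite Rminus_0_r, Rabs_right; lra. }
  assert (H8 : t * (8 * K) < 1).
  { apply (Rmult_lt_compat_r (8 * K)) in HtK; [| lra].
    rewrite Rinv_l in HtK; lra. }
  assert (Ht1 : t < 1) by nra.
  apply (Rle_lt_trans _ K _ HMK).
  apply (Rmult_lt_reg_l (4 * t ^ 2)); [nra |].
  assert (4 * t ^ 2 * K < 1 / 2) by nra. lra.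
Qed.

(** * Surjectivity and assembly *)

Lemma SNR_of_angle_surjective (y : R) :
  0 < y -> exists t : R, 0 < t < PI / 2 /\ SNR_of_angle t = y.
Proof.
  intros Hy. assert (HPI := PI_RGT_0).
  assert (HPI2 : 0 < PI / 2) by lra.
  assert (Hbig : at_right 0 (fun t => y < SNR_of_angle t)).
  { apply SNR_of_angle_lim_0. exists y. intros z Hz. exact Hz. }
  destruct Hbig as [d Hd].
  assert (Hmin : 0 < Rmin d (PI / 2)) by (apply Rmin_pos; [apply cond_pos | lra]).
  assert (Hl := Rmin_l d (PI / 2)). assert (Hr := Rmin_r d (PI / 2)).
  set (a := Rmin d (PI / 2) / 2).
  assert (Ha : 0 < a < PI / 2) by (unfold a; lra).
  assert (Hya : y < SNR_of_angle a).
  { apply Hd; [| lra]. change (Rabs (a - 0) < d).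
    rewrite Rminus_0_r, Rabs_right; unfold a; lra. }
  (* The difference is taken in this order because [IVT_interv] expects a negative value on the left
     and a positive one on the right. *)
  destruct (IVT_interv (fun t => y - SNR_of_angle t) a (PI / 2)) as [t [Ht Et]].
  - intros t Ht. apply continuity_pt_filterlim.
    apply (continuous_minus (fun _ => y) SNR_of_angle);
      [apply continuous_const | apply continuous_SNR_of_angle; lra].
  - lra.
  - lra.
  - rewrite SNR_of_angle_PI2. lra.
  - exists t. split; [| lra]. split; [lra |].
    (* The root cannot be [PI / 2], where the SNR is 0 and not [y]. *)
    destruct (Rle_lt_or_eq_dec t (PI / 2) (proj2 Ht)) as [| E]; [assumption |].
    rewrite E, SNR_of_angle_PI2 in Et. lra.
Qed.

Theorem proposition1 :
  (forall theta : R, 0 < theta < PI / 2 ->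
     unique (fun snr : R => 0 < snr /\ has_cutoff_angle snr theta)
            (SNR_of_angle theta)
     /\ (forall snr : R, 0 < snr ->
           (has_cutoff_angle snr theta <->
            power_constraint snr (1 / (4 * snr * (sin theta) ^ 2))
                             (4 * (sin theta) ^ 2))))
  /\ (forall theta1 theta2 : R,
        0 < theta1 -> theta1 < theta2 -> theta2 < PI / 2 ->
        SNR_of_angle theta2 < SNR_of_angle theta1)
  /\ (forall theta : R, 0 < theta < PI / 2 -> 0 < SNR_of_angle theta)
  /\ (forall y : R, 0 < y ->
        exists! theta : R, 0 < theta < PI / 2 /\ SNR_of_angle theta = y)
  /\ filterlim SNR_of_angle (at_left (PI / 2)) (locally 0)
  /\ filterlim (fun theta => 4 * theta ^ 2 * SNR_of_angle theta)
       (at_right 0) (locally 1)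
  /\ filterlim SNR_of_angle (at_right 0) (Rbar_locally p_infty).
Proof.
  split; [| split; [| split; [| split; [| split; [| split]]]]].
  - intros t Ht. split; [split |].
    + assert (Hpos := SNR_of_angle_pos t Ht). split; [exact Hpos |].
      apply has_cutoff_angle_iff; [exact Hpos | exact Ht |].
      apply power_constraint_iff; [exact Hpos | exact Ht | reflexivity].
    + intros snr [Hsnr Hcut]. symmetry.
      apply power_constraint_iff; [exact Hsnr | exact Ht |].
      apply has_cutoff_angle_iff; assumption.
    + intros snr Hsnr. apply has_cutoff_angle_iff; assumption.
  - intros t1 t2 H1 H12 H2. apply SNR_of_angle_decreasing; lra.
  - exact SNR_of_angle_pos.
  - intros y Hy. destruct (SNR_of_angle_surjective y Hy) as [t [Ht Et]].
    exists t. split; [split; assumption |].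
    intros u [Hu Eu].
    destruct (Rtotal_order t u) as [H | [H | H]]; [| exact H |].
    + assert (D := SNR_of_angle_decreasing t u). lra.
    + assert (D := SNR_of_angle_decreasing u t). lra.
  - exact SNR_of_angle_lim_PI2.
  - exact SNR_of_angle_equiv_0.
  - exact SNR_of_angle_lim_0.
Qed.
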